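(* Let $n\geq 1$, let $Q\in\mathbb{R}^{n\times n}$ be a symmetric matrix and let $f\in\mathbb{R}^{n}$. Assume that $\overline{\sigma}\in\mathbb{R}^n$ is a critical point of $P^{d}$ such that $\det Q_{d}(\overline{\sigma})\neq 0$, and let $\overline{x}:=\left[Q_{d}(\overline{\sigma})\right]^{-1}(f+\overline{\sigma})$. Then $\overline{x}\in\mathcal{X}_{a}$ and $$P(\overline{x})=\Xi(\overline{x},\overline{\sigma})=P^{d}(\overline{\sigma}).$$ (a) If $\overline{\sigma}\in\mathcal{S}_{\sharp}^{+}$, then $\overline{\sigma}$ is a global maximizer of $P^{d}$ over $\mathcal{S}_{\sharp}^{+}$ and $\overline{x}$ is a global minimizer of $P$ over $\mathcal{X}:=[0,1]^{n}$; in particular, $\overline{x}$ is a global minimizer of $P$ over $\mathcal{X}_{a}=\{0,1\}^{n}$. (b) If $\overline{\sigma}\in\mathcal{S}_{\sharp}^{-}$, then $\overline{x}$ is a local minimizer of $P$ over $\mathcal{X}=[0,1]^n$ and $\overline{\sigma}$ is a global minimizer of $P^{d}$ over $\mathcal{S}_{\sharp}^{-}$.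
   Context: For a symmetric matrix $Q\in\mathbb{R}^{n\times n}$ and $f\in\mathbb{R}^n$, the following notation is used. - $P:\mathbb{R}^n\to\mathbb{R}$, $P(x)=\tfrac{1}{2}x^{T}Qx-f^{T}x$. - $\mathcal{X}_{a}=\{x\in\mathbb{R}^{n}\mid 0\leq x_{i}\leq 1,\ x_i\text{ is an integer},\ i=1,\ldots,n\}=\{0,1\}^n$. - For $\sigma\in\mathbb{R}^n$, $\operatorname{Diag}(\sigma)\in\mathbb{R}^{n\times n}$ is the diagonal matrix with diagonal entries $\sigma_1,\ldots,\sigma_n$, and $Q_{d}(\sigma)=Q+2\operatorname{Diag}(\sigma)$. - $\Xi:\mathbb{R}^n\times\mathbb{R}^n\to\mathbb{R}$, $\Xi(x,\sigma)=\tfrac{1}{2}x^{T}Q_{d}(\sigma)x-x^{T}(f+\sigma)$. - $P^{d}(\sigma)=-\tfrac{1}{2}(f+\sigma)^{T}[Q_{d}(\sigma)]^{-1}(f+\sigma)$, defined on the open set $\{\sigma\in\mathbb{R}^n\mid \det Q_d(\sigma)\neq 0\}$. A critical point of $P^d$ is a point $\sigma$ of this set at which the (Fréchet) derivative of $P^d$ vanishes, i.e. $\nabla P^d(\sigma)=0$. - $\mathcal{S}_{\sharp}^{+}=\{\sigma\in\mathbb{R}^{n}\mid\sigma>0,\ Q_{d}(\sigma)\text{ is positive definite}\}$ and $\mathcal{S}_{\sharp}^{-}=\{\sigma\in\mathbb{R}^{n}\mid\sigma>0,\ Q_{d}(\sigma)\text{ is negative definite}\}$, where $\sigma>0$ means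 $\sigma_i>0$ for all $i=1,\ldots,n$. A point $\overline{x}\in\mathcal{X}$ is a local minimizer of $P$ over $\mathcal{X}$ if there is a neighborhood $U$ of $\overline{x}$ in $\mathbb{R}^n$ such that $P(x)\geq P(\overline{x})$ for all $x\in U\cap\mathcal{X}$. *)

(* Defs.v *)
From HB Require Import structures.
From mathcomp Require Import all_boot all_order all_algebra.
From mathcomp Require Import all_classical all_reals all_analysis.

Set Implicit Arguments.
Unset Strict Implicit.
Unset Printing Implicit Defensive.

Import Order.TTheory GRing.Theory Num.Theory.
Import numFieldNormedType.Exports.

Local Open Scope classical_set_scope.
Local Open Scope ring_scope.

Section Optimization.
Variables (R : realType) (T : topologicalType).
Implicit Types (g : T -> R) (A : set T) (x : T).

Definition global_minimizer g A x := A x /\ forall y, A y -> g x <= g y.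

Definition global_maximizer g A x := A x /\ forall y, A y -> g y <= g x.

Definition local_minimizer g A x :=
  A x /\ \forall y \near x, A y -> g x <= g y.

End Optimization.

Section QuadraticProgram.
Variables (R : realType) (n : nat).
Implicit Types (M Q : 'M[R]_n) (f x y s : 'cV[R]_n).

(* The value of a 1 x 1 matrix product is read off as its (0, 0) entry. *)
Definition dotprod x y : R := (x^T *m y) 0 0.

Definition bilin M x y : R := (x^T *m M *m y) 0 0.

(* Symmetry is not included: these are only applied to symmetric matrices. *)
Definition pos_definite M := forall x, x != 0 -> 0 < bilin M x x.

Definition neg_definite M := forall x, x != 0 -> bilin M x x < 0.

Definition primal Q f x : R := 2^-1 * bilin Q x x - dotprod f x.

Definition box : set 'cV[R]_n := [set x : 'cV[R]_n | forall i, 0 <= x i 0 <= 1].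

Definition binary_box : set 'cV[R]_n :=
  [set x : 'cV[R]_n | forall i, 0 <= x i 0 <= 1 /\ x i 0 \is a Num.int].

Definition Qd Q s : 'M[R]_n := Q + 2 *: diag_mx s^T.

Definition Xi Q f x s : R := 2^-1 * bilin (Qd Q s) x x - dotprod x (f + s).

(* Only meaningful where Qd Q s is invertible; elsewhere invmx is the identity
   map and the value is junk. *)
Definition dual Q f s : R :=
  - (2^-1 * bilin (invmx (Qd Q s)) (f + s) (f + s)).

Definition dual_critical Q f s :=
  [/\ \det (Qd Q s) != 0, differentiable (dual Q f) s &
      forall h, 'd (dual Q f) s h = 0].

Definition Splus Q : set 'cV[R]_n :=
  [set s : 'cV[R]_n | (forall i, 0 < s i 0) /\ pos_definite (Qd Q s)].

Definition Sminus Q : set 'cV[R]_n :=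
  [set s : 'cV[R]_n | (forall i, 0 < s i 0) /\ neg_definite (Qd Q s)].

End QuadraticProgram.

Arguments box {R n}.
Arguments binary_box {R n}.

(* Main.v *)
Require Import Defs.
From mathcomp Require Import all_boot all_order all_algebra.
From mathcomp Require Import all_classical all_reals all_analysis.
From mathcomp Require Import ring lra.

Set Implicit Arguments.
Unset Strict Implicit.
Unset Printing Implicit Defensive.

Import Order.TTheory GRing.Theory Num.Theory.
Import numFieldNormedType.Exports.

Local Open Scope classical_set_scope.
Local Open Scope ring_scope.

(** Everything rests on two expressions for the total complementary function
    [Xi x s].  In [x], completing the square around the stationary point
    [y = (Qd s)^-1 (f + s)] gives
      [Xi x s = dual s + 1/2 (x - y)^T (Qd s) (x - y)]      ([Xi_dual]);
    in [s], it is affine: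
      [Xi x s = primal x + sum_i s_i (x_i^2 - x_i)]         ([Xi_primal]).

    By the envelope principle the partial derivative of [dual] at [s] in
    direction [i] is that of [Xi y], namely [y_i^2 - y_i].  At a critical point
    [sbar] every [y_i^2 - y_i] is thus zero, so [xbar] is a vertex of the box.
    The penalty sum then vanishes at [xbar] for every [s], so
    [Xi xbar s = primal xbar] for every [s], and the three values agree.

    Duality follows by comparing signs.  When [Qd s] is positive definite,
    [dual s] is the minimum of [Xi _ s], so [dual s <= Xi xbar s = dual sbar];
    on the box with [sbar > 0] the penalty is nonpositive, so
    [primal y >= Xi y sbar >= dual sbar = primal xbar].  When [Qd s] is negative definite, [dual s] is a
    maximum of [Xi _ s] and the first inequality is reversed.  The second one
    has no analogue there, but local minimality is elementary: the gradient of
    [primal] at [xbar] has coordinates [sbar_i (1 - 2 xbar_i)], hence points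
    strictly into the box at the vertex [xbar]. *)

Section Quadratic.
Variables (R : realType) (n : nat).
Implicit Types (A M Q : 'M[R]_n) (b f x y s : 'cV[R]_n).

(** * Definite matrices *)

Lemma unitmx_ker0 A : (forall x, A *m x = 0 -> x = 0) -> A \in unitmx.
Proof.
move=> kerA; rewrite unitmxE unitfE -det_tr; apply/det0P => -[v v0 vA].
case/eqP: v0; apply: trmx_inj; rewrite trmx0; apply: kerA.
by apply: trmx_inj; rewrite trmx_mul trmxK trmx0.
Qed.

Lemma pos_definite_unitmx A : pos_definite A -> A \in unitmx.
Proof.
move=> posA; apply: unitmx_ker0 => x Ax0; apply/eqP/negPn/negP => /posA.
by rewrite /bilin -mulmxA Ax0 mulmx0 mxE ltxx.
Qed.

Lemma neg_definite_unitmx A : neg_definite A -> A \in unitmx.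
Proof.
move=> negA; apply: unitmx_ker0 => x Ax0; apply/eqP/negPn/negP => /negA.
by rewrite /bilin -mulmxA Ax0 mulmx0 mxE ltxx.
Qed.

Lemma pos_definite_ge0 A x : pos_definite A -> 0 <= bilin A x x.
Proof.
move=> posA; have [->|/posA/ltW//] := eqVneq x 0.
by rewrite /bilin mulmx0 mxE.
Qed.

Lemma neg_definite_le0 A x : neg_definite A -> bilin A x x <= 0.
Proof.
move=> negA; have [->|/negA/ltW//] := eqVneq x 0.
by rewrite /bilin mulmx0 mxE.
Qed.

(** * Quadratic forms and completion of the square *)

Lemma dotprodE x y : dotprod x y = \sum_i x i 0 * y i 0.
Proof. by rewrite /dotprod mxE; apply: eq_bigr => i _; rewrite mxE. Qed.

Lemma dotprodC x y : dotprod x y = dotprod y x.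
Proof. by rewrite !dotprodE; apply: eq_bigr => i _; rewrite mulrC. Qed.

Lemma dotprodDr x y z : dotprod x (y + z) = dotprod x y + dotprod x z.
Proof. by rewrite /dotprod mulmxDr mxE. Qed.

Lemma dotprodNr x y : dotprod x (- y) = - dotprod x y.
Proof. by rewrite /dotprod mulmxN mxE. Qed.

Lemma dotprodZr a x y : dotprod x (a *: y) = a * dotprod x y.
Proof. by rewrite /dotprod -scalemxAr mxE. Qed.

Lemma dotprodDl x y z : dotprod (x + y) z = dotprod x z + dotprod y z.
Proof. by rewrite dotprodC dotprodDr !(dotprodC z). Qed.

Lemma dotprodNl x y : dotprod (- x) y = - dotprod x y.
Proof. by rewrite dotprodC dotprodNr dotprodC. Qed.

Lemma bilinE A x y : bilin A x y = dotprod x (A *m y).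
Proof. by rewrite /bilin -mulmxA. Qed.

Lemma dotprod_mulmx_sym A x y :
  A^T = A -> dotprod x (A *m y) = dotprod y (A *m x).
Proof. by move=> symA; rewrite dotprodC /dotprod trmx_mul symA mulmxA. Qed.

Lemma complete_square A b x : A^T = A -> A \in unitmx ->
  2^-1 * bilin A x x - dotprod x b =
  - (2^-1 * bilin (invmx A) b b)
  + 2^-1 * bilin A (x - invmx A *m b) (x - invmx A *m b).
Proof.
move=> symA unitA; set y := invmx A *m b.
have Ay : A *m y = b by rewrite mulKVmx.
rewrite !bilinE -/y mulmxBr Ay.
rewrite !(dotprodDl, dotprodDr, dotprodNl, dotprodNr).
rewrite (dotprod_mulmx_sym y x symA) Ay (dotprodC b y).
by field.
Qed.

(** A quadratic polynomial has an exact mean value formula, with the gradient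
    taken at the midpoint; the increment is thereby a sum over coordinates,
    to be signed one by one. *)
Lemma primal_sub Q f x y : Q^T = Q ->
  primal Q f x - primal Q f y =
  dotprod (x - y) (2^-1 *: (Q *m (x + y)) - f).
Proof.
move=> symQ; rewrite /primal !bilinE mulmxDr.
rewrite !(dotprodDl, dotprodDr, dotprodNl, dotprodNr, dotprodZr).
rewrite (dotprod_mulmx_sym y x symQ) !(dotprodC f).
by ring.
Qed.

(** * The total complementary function *)

Lemma Qd_tr Q s : Q^T = Q -> (Qd Q s)^T = Qd Q s.
Proof. by move=> symQ; rewrite /Qd linearD linearZ /= tr_diag_mx symQ. Qed.

Lemma Qd_mulmx Q s x i :
  (Qd Q s *m x) i 0 = (Q *m x) i 0 + 2 * (s i 0 * x i 0).
Proof.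
by rewrite /Qd mulmxDl -scalemxAl mul_diag_mx !mxE.
Qed.

Lemma Xi_primal Q f x s :
  Xi Q f x s = primal Q f x + \sum_i s i 0 * (x i 0 ^+ 2 - x i 0).
Proof.
have -> : \sum_i s i 0 * (x i 0 ^+ 2 - x i 0) =
    dotprod x (diag_mx s^T *m x) - dotprod x s.
  rewrite !dotprodE -sumrB; apply: eq_bigr => i _.
  by rewrite mul_diag_mx !mxE; ring.
rewrite /Xi /primal !bilinE /Qd mulmxDl -scalemxAl.
rewrite !(dotprodDr, dotprodZr) (dotprodC f).
by field.
Qed.

Lemma Xi_dual Q f x s : Q^T = Q -> Qd Q s \in unitmx ->
  let y := invmx (Qd Q s) *m (f + s) in
  Xi Q f x s = dual Q f s + 2^-1 * bilin (Qd Q s) (x - y) (x - y).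
Proof. by move=> symQ unitA; apply: complete_square; first exact: Qd_tr. Qed.

Lemma Xi_dual_stationary Q f s : Q^T = Q -> Qd Q s \in unitmx ->
  Xi Q f (invmx (Qd Q s) *m (f + s)) s = dual Q f s.
Proof.
move=> symQ unitA.
by rewrite Xi_dual //= subrr bilinE mulmx0 /dotprod mulmx0 mxE mulr0 addr0.
Qed.

(** * Critical points of the dual *)

(** Moving [s] by [t] along the [i]-th coordinate is a rank one change of
    [Qd Q s], so the new stationary point is [x - c *: u] with [u] the [i]-th
    column of the inverse, as in the Sherman-Morrison formula.  The resulting
    variation of the dual is exact, with the quadratic remainder explicit, so
    that differentiating requires no continuity of the matrix inverse. *)
Lemma dual_coord_step Q f s (i : 'I_n) (t : R) :
  Q^T = Q -> Qd Q s \in unitmx ->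
  let x := invmx (Qd Q s) *m (f + s) in
  let g := invmx (Qd Q s) i i in
  1 + 2 * t * g != 0 ->
  dual Q f (t *: delta_mx i 0 + s) =
  dual Q f s + t * (x i 0 ^+ 2 - x i 0)
  - t ^+ 2 * (2^-1 * (2 * x i 0 - 1) ^+ 2 * g) / (1 + 2 * t * g).
Proof.
move=> symQ unitA x g tg0; set e : 'cV[R]_n := delta_mx i 0.
set s' := t *: e + s; set A := Qd Q s; set A' := Qd Q s'.
pose u := invmx A *m e.
have ui : u i 0 = g by rewrite /u -colE mxE.
have Au : A *m u = e by rewrite mulKVmx.
have Ax : A *m x = f + s by rewrite mulKVmx.
have := Xi_dual_stationary f symQ unitA; rewrite Xi_primal -/A -/x => DE.
clearbody u x.
have A'E y : A' *m y = A *m y + (2 * t * y i 0) *: e.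
  apply/colP => k; rewrite [in RHS]mxE !Qd_mulmx !mxE eqxx andbT.
  by have [->|_] := eqVneq k i; rewrite /=; ring.
(* A vector in the kernel of A' is a multiple of u, and A' u is a nonzero
   multiple of e. *)
have unitA' : A' \in unitmx.
  apply: unitmx_ker0 => v; rewrite A'E => Av0.
  have /(can_inj (mulKmx unitA)) vE : A *m v = A *m (- (2 * t * v i 0) *: u).
    by rewrite -scalemxAr Au scaleNr; apply/eqP; rewrite -addr_eq0 Av0.
  have vi0 : v i 0 = 0.
    have : v i 0 = - (2 * t * v i 0) * g by rewrite [in LHS]vE mxE ui.
    move/eqP; rewrite -subr_eq0 => /eqP vi.
    by apply: (mulfI tg0); rewrite mulr0 -[RHS]vi; ring.
  by rewrite vE vi0 mulr0 oppr0 scale0r.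
(* The value of c solves A' (x - c u) = f + s', given A' u = (1 + 2tg) e. *)
pose c := t * (2 * x i 0 - 1) / (1 + 2 * t * g).
have yE : invmx A' *m (f + s') = x - c *: u.
  rewrite -[RHS](mulKmx unitA'); congr (_ *m _).
  rewrite A'E mulmxBr -scalemxAr Au Ax.
  apply/colP => k; rewrite !mxE ui eqxx andbT.
  by have [_|_] := eqVneq k i; rewrite /= /c; field.
(* Evaluating Xi at s' in the old stationary point x: its two expressions
   compare the dual at s' with primal x, hence with the dual at s. *)
have := Xi_dual f x symQ unitA'.
rewrite /= yE subKr bilinE -/A' -scalemxAr A'E Au ui.
have -> : e + (2 * t * g) *: e = (1 + 2 * t * g) *: e.
  by rewrite scalerDl scale1r.
rewrite scalerA dotprodZr dotprodC dotprodZr.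
have -> : dotprod e u = g.
  rewrite dotprodE (bigD1 i) //= big1 ?addr0; last first.
    by move=> k /negbTE ki; rewrite mxE ki mul0r.
  by rewrite mxE !eqxx mul1r.
rewrite Xi_primal => XiE.
have sumE : \sum_k s' k 0 * (x k 0 ^+ 2 - x k 0) =
    \sum_k s k 0 * (x k 0 ^+ 2 - x k 0) + t * (x i 0 ^+ 2 - x i 0).
  have -> : t * (x i 0 ^+ 2 - x i 0) =
      \sum_k t * (k == i)%:R * (x k 0 ^+ 2 - x k 0).
    rewrite (bigD1 i) //= eqxx mulr1 big1 ?addr0 // => k /negbTE ->.
    by rewrite mulr0 mul0r.
  rewrite -big_split; apply: eq_bigr => k _; rewrite !mxE eqxx andbT /=.
  by ring.
move: XiE; rewrite sumE addrA DE => /eqP; rewrite eq_sym -subr_eq => /eqP <-.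
by rewrite /c; field.
Qed.

(** The derivative of the dual in direction [i] is the limit of the difference
    quotients given by [dual_coord_step]. *)
Lemma dual_critical_coord Q f s (i : 'I_n) :
  Q^T = Q -> dual_critical Q f s ->
  let x := invmx (Qd Q s) *m (f + s) in x i 0 ^+ 2 - x i 0 = 0.
Proof.
move=> symQ [detA df df0] x.
have unitA : Qd Q s \in unitmx by rewrite unitmxE unitfE.
set g := invmx (Qd Q s) i i.
set w := x i 0 ^+ 2 - x i 0; pose k := 2^-1 * (2 * x i 0 - 1) ^+ 2 * g.
have den_cvg : 1 + 2 * t * g @[t --> (0 : R)^'] --> (1 : R).
  have : 1 + 2 * t * g @[t --> (0 : R)^'] --> 1 + 2 * 0 * g.
    apply: cvg_within_filter; apply: cvgD; first exact: cvg_cst.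
    apply: cvgM; last exact: cvg_cst.
    by apply: cvgM; [exact: cvg_cst | exact: cvg_id].
  by rewrite mulr0 mul0r addr0.
have quot_cvg : w - t * (k / (1 + 2 * t * g)) @[t --> (0 : R)^'] --> w.
  have : w - t * (k / (1 + 2 * t * g)) @[t --> (0 : R)^'] --> w - 0 * (k / 1).
    apply: cvgB; first exact: cvg_cst.
    apply: cvgM; first by apply: cvg_within_filter; exact: cvg_id.
    apply: cvgM; first exact: cvg_cst.
    by apply: cvgV => //; exact: oner_neq0.
  by rewrite mul0r subr0.
have := deriveE (delta_mx i 0 : 'cV[R]_n) df.
rewrite df0 => D0.
rewrite -[RHS]D0; apply/esym; apply: cvg_lim => //.
apply: cvg_trans quot_cvg; apply: near_eq_cvg.
near=> t.
have t0 : t != 0 by near: t; exact: nbhs_dnbhs_neq.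
have tg0 : 1 + 2 * t * g != 0.
  by near: t; apply: (cvgr_neq0 _ den_cvg); exact: oner_neq0.
rewrite /= dual_coord_step // -/x -/g -/w /k /GRing.scale /=.
by field; rewrite tg0 t0.
Unshelve. all: by end_near. Qed.

(** * Local minimality at a vertex *)

(** When the gradient points strictly into the box at a vertex, each coordinate
    of the midpoint gradient of [primal_sub] keeps its sign near [x], which is
    also the sign of the increment of that coordinate inside the box. *)
Lemma box_local_minimizer Q f x : Q^T = Q ->
  (forall i, x i 0 = 0 /\ 0 < (Q *m x - f) i 0 \/
             x i 0 = 1 /\ (Q *m x - f) i 0 < 0) ->
  local_minimizer (primal Q f) box x.
Proof.
move=> symQ gradx; split.
  by move=> i; case: (gradx i) => -[-> _]; rewrite lexx ler01.
pose c y := 2^-1 *: (Q *m (y + x)) - f.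
have c_cvg i : c y i 0 @[y --> x] --> (Q *m x - f) i 0.
  have -> : (Q *m x - f) i 0 = c x i 0.
    rewrite /c mulmxDr scalerDr -scalerDl.
    by rewrite (_ : 2^-1 + 2^-1 = 1) ?scale1r //; field.
  have cE y : c y i 0 = 2^-1 * (\sum_j Q i j * (y j 0 + x j 0)) - f i 0.
    rewrite !mxE; congr (_ * _ - _).
    by apply: eq_bigr => j _; rewrite mxE.
  have coord_cvg j : (fun y : 'cV[R]_n => y j 0) @ x --> x j 0.
    by exact: coord_continuous.
  rewrite (funext cE) cE; move: (nbhs_filter x) coord_cvg.
  (* Only the filter structure matters from here; abstracting the neighborhood
     filter keeps it from being unfolded entrywise. *)
  move: (nbhs x) => F FF coordF.
  apply: cvgB; last exact: cvg_cst.
  apply: cvgM; first exact: cvg_cst.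
  apply: cvg_big => [|j _]; first exact: add_continuous.
  apply: cvgM; first exact: cvg_cst.
  apply: cvgD; last exact: cvg_cst.
  exact: coordF.
have sign i : \forall y \near x, box y -> 0 <= (y i 0 - x i 0) * c y i 0.
  case: (gradx i) => -[xi gi].
    have c_gt0 : \forall y \near x, 0 < c y i 0.
      exact: (cvgr_gt _ (c_cvg i)).
    apply: filterS c_gt0 => y cy boxy.
    have /andP[y0 _] := boxy i.
    by rewrite xi subr0; apply: mulr_ge0 y0 (ltW cy).
  have c_lt0 : \forall y \near x, c y i 0 < 0.
    exact: (cvgr_lt _ (c_cvg i)).
  apply: filterS c_lt0 => y cy boxy.
  have /andP[_ y1] := boxy i.
  by rewrite xi; apply: mulr_le0 (ltW cy); rewrite subr_le0.
have signs := filter_forall (nbhs_filter x) sign.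
apply: filterS signs => y signy boxy.
rewrite -subr_ge0 primal_sub // dotprodE; apply: sumr_ge0 => i _.
by have := signy i boxy; rewrite !mxE.
Qed.

(** * Weak duality *)

Lemma dual_le_Xi Q f x s : Q^T = Q -> pos_definite (Qd Q s) ->
  dual Q f s <= Xi Q f x s.
Proof.
move=> symQ posA; rewrite Xi_dual ?pos_definite_unitmx//= lerDl.
by rewrite mulr_ge0 ?invr_ge0 ?ler0n ?pos_definite_ge0.
Qed.

Lemma Xi_le_dual Q f x s : Q^T = Q -> neg_definite (Qd Q s) ->
  Xi Q f x s <= dual Q f s.
Proof.
move=> symQ negA; rewrite Xi_dual ?neg_definite_unitmx//= gerDl.
by rewrite mulr_ge0_le0 ?invr_ge0 ?ler0n ?neg_definite_le0.
Qed.

Lemma Xi_le_primal Q f x s : box x -> (forall i, 0 < s i 0) ->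
  Xi Q f x s <= primal Q f x.
Proof.
move=> boxx s_gt0; rewrite Xi_primal gerDl; apply: sumr_le0 => i _.
have /andP[xi0 xi1] := boxx i.
by apply: mulr_ge0_le0 (ltW (s_gt0 i)) _; rewrite subr_le0 expr2 ler_piMl.
Qed.

(** The value does not depend on [s]: this lets one vertex compare the dual
    values at all multipliers. *)
Lemma Xi_primal_vertex Q f x s : (forall i, x i 0 ^+ 2 - x i 0 = 0) ->
  Xi Q f x s = primal Q f x.
Proof.
by move=> vx; rewrite Xi_primal big1 ?addr0// => i _; rewrite vx mulr0.
Qed.

End Quadratic.

Theorem theorem3 (R : realType) (n : nat) (hn : (1 <= n)%N)
    (Q : 'M[R]_n) (hQ : Q^T = Q) (f sbar : 'cV[R]_n)
    (hcrit : dual_critical Q f sbar) (hdet : \det (Qd Q sbar) != 0) :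
  let xbar : 'cV[R]_n := invmx (Qd Q sbar) *m (f + sbar) in
  [/\ binary_box xbar,
      primal Q f xbar = Xi Q f xbar sbar,
      Xi Q f xbar sbar = dual Q f sbar,
      (Splus Q sbar ->
         [/\ global_maximizer (dual Q f) (Splus Q) sbar,
             global_minimizer (primal Q f) box xbar &
             global_minimizer (primal Q f) binary_box xbar]) &
      (Sminus Q sbar ->
         local_minimizer (primal Q f) box xbar /\
         global_minimizer (dual Q f) (Sminus Q) sbar)].
Proof.
move=> xbar.
have unitA : Qd Q sbar \in unitmx by rewrite unitmxE unitfE.
have vertex i : xbar i 0 ^+ 2 - xbar i 0 = 0 by exact: dual_critical_coord.
have vertexP i : xbar i 0 = 0 \/ xbar i 0 = 1.
  have /eqP := vertex i; rewrite expr2 -{3}[xbar i 0]mulr1 -mulrBr mulf_eq0.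
  by rewrite subr_eq0 => /orP[] /eqP; [left|right].
have Axbar : Qd Q sbar *m xbar = f + sbar by rewrite mulKVmx.
have binx : binary_box xbar.
  by move=> i; case: (vertexP i) => ->; rewrite lexx ler01 ?int_num0 ?int_num1.
have binary_sub : binary_box `<=` (@box R n) by move=> y biny i; case: (biny i).
have Xi_xbar s : Xi Q f xbar s = primal Q f xbar by exact: Xi_primal_vertex.
have dual_sbar : Xi Q f xbar sbar = dual Q f sbar by exact: Xi_dual_stationary.
split => // [[s_gt0 posA]|[s_gt0 negA]].
  have min_box y : box y -> primal Q f xbar <= primal Q f y.
    move=> boxy; rewrite -(Xi_xbar sbar) dual_sbar.
    exact: le_trans (dual_le_Xi f y hQ posA) (Xi_le_primal Q f boxy s_gt0).
  split; split; [by []| | exact: binary_sub | by [] | by [] | ].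
    move=> s [_ posAs]; rewrite -dual_sbar Xi_xbar -(Xi_xbar s).
    exact: dual_le_Xi.
  by move=> y /binary_sub/min_box.
split; last first.
  split=> // s [_ negAs]; rewrite -dual_sbar Xi_xbar -(Xi_xbar s).
  exact: Xi_le_dual.
apply: box_local_minimizer => // i.
have grad : (Q *m xbar - f) i 0 = sbar i 0 * (1 - 2 * xbar i 0).
  have := Qd_mulmx Q sbar xbar i; rewrite Axbar mxE => e.
  by rewrite mxE [X in _ + X]mxE; lra.
rewrite grad; case: (vertexP i) => ->; [left|right]; split=> //;
  have := s_gt0 i; lra.
Qed.
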